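(* Let $S$ be a Hilbert-style proof system for the implicational propositional language whose only inference rule is modus ponens and whose axioms include all instances of the schemes $A \supset (B \supset A)$ and $[A \supset (B \supset C)] \supset [(A \supset B) \supset (A \supset C)]$ (and possibly instances of further axiom schemes). Then every instance of the Peirce scheme $[(A \supset B) \supset A] \supset A$ is a theorem of $S$ if and only if for all well-formed formulas $A, B, Q$ we have $A \supset Q,\ B \supset Q \vdash_S (A \vee B) \supset Q$, where $A \vee B$ abbreviates $(A \supset B) \supset B$.
   Context: The implicational propositional language has propositional variables and the single binary connective $\supset$; well-formed formulas are built from variables using $\supset$. $\Gamma \vdash_S C$ means $C$ is deducible in $S$ from the hypotheses $\Gamma$ using the axioms of $S$ and modus ponens (from $A$ and $A \supset B$ infer $B$); a theorem of $S$ is a formula deducible from no hypotheses. The notation $A \vee B$ is an abbreviation for $(A \supset B) \supset B$. *)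

(* Defs.v *)
From Stdlib Require Import Ensembles.

Set Implicit Arguments.

Inductive formula (V : Type) : Type :=
| Var : V -> formula V
| Imp : formula V -> formula V -> formula V.

Declare Scope formula_scope.
Delimit Scope formula_scope with form.
Bind Scope formula_scope with formula.

Notation "A ⊃ B" := (Imp A B) (at level 61, right associativity) : formula_scope.
Notation "A ∨ B" := (Imp (Imp A B) B)
  (at level 50, left associativity, only parsing) : formula_scope.

(* Modus ponens is the only rule, so a Hilbert system is identified with its
   set [S] of axioms; [derives S Γ C] is Γ ⊢_S C. *)
Inductive derives (V : Type) (S Γ : Ensemble (formula V)) : formula V -> Prop :=
| derives_hyp : forall C, In _ Γ C -> derives S Γ C
| derives_ax : forall C, In _ S C -> derives S Γ C
| derives_mp : forall A B,
    derives S Γ (A ⊃ B) -> derives S Γ A -> derives S Γ B.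

Definition is_theorem (V : Type) (S : Ensemble (formula V)) (C : formula V) : Prop :=
  derives S (Empty_set _) C.

(* Main.v *)
(** Left to right: given [A ⊃ Q], [B ⊃ Q] and [A ∨ B], a further hypothesis
    [Q ⊃ B] yields [A ⊃ B], hence [B], hence [Q]; so [(Q ⊃ B) ⊃ Q], and Peirce's
    law yields [Q].  Right to left: [A ∨ (A ⊃ B)] is the contraction
    [(A ⊃ (A ⊃ B)) ⊃ (A ⊃ B)], a theorem, so case analysis on it with [Q := A]
    derives [A] from [A ⊃ A] and [(A ⊃ B) ⊃ A]. *)

Require Import Defs.
From Stdlib Require Import Ensembles.

(** Derivations of the hypotheses are grafted onto the leaves. Case analysis is given for a fixed
    pair of hypotheses, so this moves it to other contexts. *)
Lemma derives_cut (V : Type) (S Γ Δ : Ensemble (formula V)) (C : formula V) :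
  derives S Γ C -> (forall H, In _ Γ H -> derives S Δ H) -> derives S Δ C.
Proof.
  intros HC HΓ; induction HC as [C HC | C HC | A B _ IHAB _ IHA].
  - exact (HΓ C HC).
  - now apply derives_ax.
  - exact (derives_mp IHAB IHA).
Qed.

Lemma theorem_derives (V : Type) (S Γ : Ensemble (formula V)) (C : formula V) :
  is_theorem S C -> derives S Γ C.
Proof. intros HC; apply (derives_cut _ _ _ _ _ HC); intros _ []. Qed.

(** The combinator identity I = SKK. *)
Lemma derives_imp_refl (V : Type) (S Γ : Ensemble (formula V))
  (axK : forall A B : formula V, In _ S (A ⊃ (B ⊃ A))%form)
  (axS : forall A B C : formula V,
     In _ S ((A ⊃ (B ⊃ C)) ⊃ ((A ⊃ B) ⊃ (A ⊃ C)))%form)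
  (A : formula V) :
  derives S Γ (A ⊃ A)%form.
Proof.
  apply derives_mp with (A ⊃ (A ⊃ A))%form; [| now apply derives_ax].
  apply derives_mp with (A ⊃ ((A ⊃ A) ⊃ A))%form; now apply derives_ax.
Qed.

(** With modus ponens as the only rule, [axS] carries the implication through it and [axK] treats
    the leaves other than [A], whatever further axioms there are. *)
Lemma deduction (V : Type) (S Γ : Ensemble (formula V))
  (axK : forall A B : formula V, In _ S (A ⊃ (B ⊃ A))%form)
  (axS : forall A B C : formula V,
     In _ S ((A ⊃ (B ⊃ C)) ⊃ ((A ⊃ B) ⊃ (A ⊃ C)))%form)
  (A C : formula V) :
  derives S (Add _ Γ A) C -> derives S Γ (A ⊃ C)%form.
Proof.
  intros HC; induction HC as [C HC | C HC | B C _ IHBC _ IHB].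
  - destruct HC as [C HC | C HC].
    + apply derives_mp with C; [now apply derives_ax | now apply derives_hyp].
    + destruct HC; now apply derives_imp_refl.
  - apply derives_mp with C; now apply derives_ax.
  - apply derives_mp with (A ⊃ B)%form; [| exact IHB].
    apply derives_mp with (A ⊃ (B ⊃ C))%form; [now apply derives_ax | exact IHBC].
Qed.

Ltac hyp := apply derives_hyp; unfold Add; auto with sets.

Theorem theorem4 (V : Type) (S : Ensemble (formula V))
  (axK : forall A B : formula V, In _ S (A ⊃ (B ⊃ A))%form)
  (axS : forall A B C : formula V,
     In _ S ((A ⊃ (B ⊃ C)) ⊃ ((A ⊃ B) ⊃ (A ⊃ C)))%form) :
  (forall A B : formula V, is_theorem S (((A ⊃ B) ⊃ A) ⊃ A)%form)
  <->
  (forall A B Q : formula V,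
     derives S (Couple _ (A ⊃ Q)%form (B ⊃ Q)%form) ((A ∨ B) ⊃ Q)%form).
Proof.
  split.
  - intros peirce A B Q.
    apply deduction; auto.
    apply derives_mp with ((Q ⊃ B) ⊃ Q)%form; [now apply theorem_derives |].
    apply deduction; auto.
    apply derives_mp with B; [hyp |].
    apply derives_mp with (A ⊃ B)%form; [hyp |].
    apply deduction; auto.
    apply derives_mp with Q; [hyp |].
    apply derives_mp with A; hyp.
  - intros cases A B.
    apply deduction; auto.
    apply derives_mp with (A ∨ (A ⊃ B))%form.
    + apply (derives_cut _ _ _ _ _ (cases A (A ⊃ B)%form A)).
      intros H [|]; [now apply derives_imp_refl | hyp].
    (* Contraction: [A ⊃ (A ⊃ B)] is applied to the same [A] twice. *)
    + apply deduction; auto.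
      apply deduction; auto.
      apply derives_mp with A; [| hyp].
      apply derives_mp with A; hyp.
Qed.
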